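(* Let $\mathfrak{n}^{\mathbb{Q}}$ be a finite-dimensional graded rational Lie algebra and let $m\geq 2$. Let $\tilde{\mathfrak{n}}^{\mathbb{Q}}=\mathfrak{n}^{\mathbb{Q}}\oplus\cdots\oplus\mathfrak{n}^{\mathbb{Q}}$ ($m$ copies, direct sum of Lie algebras) and $\tilde{\mathfrak{n}}^{\mathbb{R}}=\mathbb{R}\otimes_{\mathbb{Q}}\tilde{\mathfrak{n}}^{\mathbb{Q}}$. Then there exists a rational form of $\tilde{\mathfrak{n}}^{\mathbb{R}}$ which is Anosov.
   Context: A Lie algebra $\mathfrak{n}$ over a field is graded if there are subspaces $\mathfrak{n}_1,\ldots,\mathfrak{n}_k$ with $\mathfrak{n}=\mathfrak{n}_1\oplus\cdots\oplus\mathfrak{n}_k$ and $[\mathfrak{n}_i,\mathfrak{n}_j]\subseteq\mathfrak{n}_{i+j}$ (with $\mathfrak{n}_l=0$ for $l>k$). A rational form of a real Lie algebra $\mathfrak{g}$ is a rational Lie subalgebra $\mathfrak{m}\subseteq \mathfrak{g}$ such that a $\mathbb{Q}$-basis of $\mathfrak{m}$ is an $\mathbb{R}$-basis of $\mathfrak{g}$. A rational Lie algebra is Anosov if it admits an automorphism that is hyperbolic (no eigenvalue of absolute value $1$) and integer-like (characteristic polynomial with integer coefficients and determinant $\pm1$). *)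

(* Defs.v *)
From HB Require Import structures.
From mathcomp Require Import all_boot all_order all_algebra.
From mathcomp Require Import algC.
Set Implicit Arguments. Unset Strict Implicit. Unset Printing Implicit Defensive.
Import Order.TTheory GRing.Theory Num.Theory.
Local Open Scope ring_scope.

(* A finite-dimensional Lie algebra over F is presented on F^n (row vectors)
   by its structure constants c i j = [e_i, e_j]. *)
Definition lie_bracket (F : fieldType) (n : nat) (c : 'I_n -> 'I_n -> 'rV[F]_n)
  (u v : 'rV[F]_n) : 'rV[F]_n :=
  \sum_(i < n) \sum_(j < n) (u 0 i * v 0 j) *: c i j.

(* Lie algebra axioms (bilinearity is automatic from the definition above). *)
Definition is_lie (F : fieldType) (n : nat) (br : 'rV[F]_n -> 'rV[F]_n -> 'rV[F]_n) : Prop :=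
  (forall u, br u u = 0) /\
  (forall u v w, br u (br v w) + br v (br w u) + br w (br u v) = 0).

Definition graded (F : fieldType) (n : nat) (br : 'rV[F]_n -> 'rV[F]_n -> 'rV[F]_n) : Prop :=
  exists (k : nat) (V : nat -> 'M[F]_n),
    ((\sum_(1 <= i < k.+1) V i)%MS == 1%:M)%MS /\
    mxdirect (\sum_(1 <= i < k.+1) V i)%MS /\
    (forall (i j : nat) (u v : 'rV[F]_n),
        (1 <= i <= k)%N -> (1 <= j <= k)%N ->
        (u <= V i)%MS -> (v <= V j)%MS ->
        if (i + j <= k)%N then (br u v <= V (i + j)%N)%MS else br u v == 0).

Definition dsum_bracket (F : fieldType) (n m : nat)
  (br : 'rV[F]_n -> 'rV[F]_n -> 'rV[F]_n) (u v : 'rV[F]_(m * n)) : 'rV[F]_(m * n) :=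
  mxvec (\matrix_(i < m) br (row i (vec_mx u)) (row i (vec_mx v))).

(* Rational form of a real Lie algebra (R^N, brR): the Q-span m of the rows of B,
   where the rows of B form an R-basis (B invertible) and m is closed under the
   bracket, with rational structure constants d w.r.t. this Q-basis.
   The rational Lie algebra m is then isomorphic to (Q^N, lie_bracket d). *)
Definition rational_form (R : rcfType) (N : nat)
  (brR : 'rV[R]_N -> 'rV[R]_N -> 'rV[R]_N)
  (B : 'M[R]_N) (d : 'I_N -> 'I_N -> 'rV[rat]_N) : Prop :=
  B \in unitmx /\
  forall i j : 'I_N, brR (row i B) (row j B) = map_mx (@ratr R) (d i j) *m B.

Definition anosov (N : nat) (br : 'rV[rat]_N -> 'rV[rat]_N -> 'rV[rat]_N) : Prop :=
  exists A : 'M[rat]_N,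
    A \in unitmx /\
    (forall u v, br (u *m A) (v *m A) = br u v *m A) /\
    (forall z : algC, eigenvalue (map_mx (@ratr algC) A) z -> `|z| != 1) /\
    char_poly A \is a polyOver Num.int /\
    (\det A = 1 \/ \det A = -1).

(* Main.v *)
Require Import Defs.
From HB Require Import structures.
From mathcomp Require Import all_boot all_order all_algebra.
From mathcomp Require Import algC algnum.
From mathcomp Require Import lra zify.
Import Order.TTheory GRing.Theory Num.Theory.
Local Open Scope ring_scope.

Set Implicit Arguments.
Unset Strict Implicit.

(** Let [p = x (x - 4) ... (x - 4 (m - 1)) + 1] and [E = Q[x] / (p)].  The
    polynomial [p] changes sign on each [[4 i - 1, 4 i + 1]], so it has [m]
    distinct real roots, evaluation at which identifies [R (x) E] with [R^m];
    hence [E (x) n], seen as a Lie algebra over [Q], is a rational form of the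
    sum of [m] copies of [R (x) n].  Multiplication by [x ^ i] on the degree [i]
    component defines an automorphism of [E (x) n] whose eigenvalues are the
    [w ^ i] with [i > 0] and [p(w) = 0].  Since [p] is monic and integral with
    [p(0) = 1], these are algebraic units, which makes the automorphism
    integer-like; and [p] has no root on the unit circle, where the product of
    the [x - 4 i] has absolute value at least [3]. *)

(** * Eigenvalues of matrices and of their powers *)

Lemma eigenvalue_unitmx (F : fieldType) (n : nat) (A : 'M[F]_n) (z : F) :
  eigenvalue A z = (A - z%:M \notin unitmx).
Proof. by rewrite /eigenvalue /eigenspace kermx_eq0 row_free_unit. Qed.

(** [eigenvalue] is about row vectors, whereas [U] collects columns; an invertible [A - z%:M] would
    force [U = 0]. *)
Lemma eigenvalue_col (F : fieldType) (m n : nat) (A : 'M[F]_m)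
    (U : 'M[F]_(m, n)) (z : F) :
  A *m U = z *: U -> U != 0 -> eigenvalue A z.
Proof.
rewrite eigenvalue_unitmx => AU; apply: contraNN => uA.
have: (A - z%:M) *m U = 0 by rewrite mulmxBl AU mul_scalar_mx subrr.
by move/(canRL (mulKmx uA)) ->; rewrite mulmx0.
Qed.

(** Over a closed field ['X^j - z] splits, so [C ^+ j - z] is a product of matrices [C - w] with
    [w ^+ j = z]; if it is singular, so is one factor. *)
Lemma eigenvalue_exp (F : closedFieldType) (m j : nat) (C : 'M[F]_m) (z : F) :
  (0 < j)%N -> eigenvalue (C ^+ j) z ->
  exists2 w, eigenvalue C w & z = w ^+ j.
Proof.
case: m C => [|m] C j_gt0.
  by case/eigenvalueP=> v _; rewrite thinmx0 eqxx.
have [r Er] := closed_field_poly_normal ('X^j - z%:P).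
rewrite lead_coefXnsubC // scale1r in Er.
rewrite eigenvalue_unitmx.
rewrite (_ : _ - _ = horner_mx C ('X^j - z%:P)); last first.
  by rewrite rmorphB /= rmorphXn /= horner_mx_X horner_mx_C.
rewrite Er rmorph_prod unitmxE unitfE negbK /=.
rewrite (big_morph _ (@det_mulmx _ m.+1) (@det1 _ m.+1)) prodf_seq_eq0.
case/hasP=> w wr /= detw; exists w.
  rewrite eigenvalue_unitmx unitmxE unitfE negbK.
  by rewrite rmorphB /= horner_mx_X horner_mx_C in detw.
have: root ('X^j - z%:P) w by rewrite Er root_prod_XsubC.
by rewrite rootE !hornerE subr_eq0 => /eqP.
Qed.

(** * Rational matrices whose eigenvalues are algebraic units *)

Section UnitEigenvalues.

Variables (N : nat) (A : 'M[rat]_N).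
Hypothesis A_eigen : forall z : algC,
  eigenvalue (map_mx ratr A) z -> [/\ z != 0, z \in Aint & z^-1 \in Aint].

Let int_of_Aint (q : rat) : ratr q \in Aint -> q \is a Num.int.
Proof.
move=> /(Cint_rat_Aint (Crat_rat q)) /intrP[k Ek].
by apply/intrP; exists k; apply: (fmorph_inj (@ratr algC)); rewrite /= Ek ratr_int.
Qed.

(** The coefficients of [char_poly A] are rational and polynomial in the eigenvalues, hence
    algebraic integers, hence integers. The constant one is up to sign the product of the
    eigenvalues, so its inverse is an integer as well. *)
Lemma unit_eigenvalues_int :
  [/\ A \in unitmx, char_poly A \is a polyOver Num.int
    & \det A = 1 \/ \det A = -1].
Proof.
have [r Er] := closed_field_poly_normal (map_poly ratr (char_poly A) : {poly algC}).
rewrite (monicP _) ?scale1r in Er; last by rewrite map_monic char_poly_monic.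
have rP z : z \in r -> [/\ z != 0, z \in Aint & z^-1 \in Aint].
  move=> zr; apply: A_eigen; rewrite eigenvalue_root_char -map_char_poly.
  by rewrite Er root_prod_XsubC.
have intA : char_poly A \is a polyOver Num.int.
  apply/polyOverP=> i; apply: int_of_Aint; rewrite -coef_map Er.
  have /polyOverP : \prod_(z <- r) ('X - z%:P) \is a polyOver Aint.
    by rewrite big_seq rpred_prod // => z /rP[_ zA _]; rewrite rpredB ?polyOverX ?polyOverC.
  exact.
have c0 : ratr (char_poly A)`_0 = \prod_(z <- r) - z :> algC.
  rewrite -coef_map Er -horner_coef0 horner_prod.
  by apply: eq_bigr => z _; rewrite !hornerE.
have c0_neq0 : (char_poly A)`_0 != 0.
  rewrite -(fmorph_eq0 (@ratr algC)) /= c0 prodf_seq_neq0; apply/allP=> z /rP[z0 _ _] /=.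
  by rewrite oppr_eq0.
have c0_int : (char_poly A)`_0 \is a Num.int by apply/polyOverP.
have c0V_int : ((char_poly A)`_0)^-1 \is a Num.int.
  apply: int_of_Aint; rewrite fmorphV /= c0 -prodfV big_seq rpred_prod // => z /rP[_ _ zA].
  by rewrite invrN rpredN.
have d0 : (char_poly A)`_0 = 1 \/ (char_poly A)`_0 = -1.
  case/intrP: c0_int c0V_int c0_neq0 => a ->; case/intrP=> b Eb a0.
  have /eqP : a%:~R * b%:~R = 1%:~R :> rat by rewrite -Eb divff.
  rewrite -intrM eqr_int => /eqP ab.
  have : b * a = 1 by rewrite mulrC.
  by case/intUnitRing.unitzPl/orP=> /eqP ->; [left | right].
have dN : \det A = 1 \/ \det A = -1.
  have: \det A = (-1) ^+ N * (char_poly A)`_0.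
    by rewrite char_poly_det mulrA -exprD addnn -mul2n exprM sqrrN !expr1n mul1r.
  rewrite -signr_odd; case: d0 => -> ->; case: (odd N) => /=;
    rewrite ?expr0 ?expr1 ?mul1r ?mulrNN ?mulr1; auto.
split=> //; rewrite unitmxE unitfE.
by case: dN => ->; rewrite ?oppr_eq0 oner_eq0.
Qed.

End UnitEigenvalues.

(** * The polynomial [p] and its complex and real roots *)

Definition shifted_split_poly (K : nzRingType) (m : nat) : {poly K} :=
  \prod_(i < m) ('X - (4 * i)%:R%:P) + 1.

Section ShiftedSplitPoly.

Variable m : nat.
Local Notation p K := (shifted_split_poly K m).

Lemma map_shifted_split_poly (K L : nzRingType) (f : {rmorphism K -> L}) :
  map_poly f (p K) = p L.
Proof.
rewrite /shifted_split_poly rmorphD rmorph1 rmorph_prod.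
by under eq_bigr do rewrite rmorphB /= map_polyX map_polyC /= rmorph_nat.
Qed.

Lemma root_shifted_split_poly (K : comNzRingType) (x : K) :
  root (p K) x = (\prod_(i < m) (x - (4 * i)%:R) == -1).
Proof.
rewrite rootE /shifted_split_poly hornerD horner_prod hornerC addr_eq0.
by under eq_bigr do rewrite !hornerE.
Qed.

Let size_prod (K : idomainType) :
  size (\prod_(i < m) ('X - (4 * i)%:R%:P) : {poly K}) = m.+1.
Proof. by rewrite size_prod_XsubC /index_enum -enumT size_enum_ord. Qed.

Lemma size_shifted_split_poly (K : idomainType) :
  (0 < m)%N -> size (p K) = m.+1.
Proof.
move=> m_gt0.
by rewrite /shifted_split_poly size_polyDl size_prod // size_poly1.
Qed.

Lemma shifted_split_poly_monic (K : idomainType) : (0 < m)%N -> p K \is monic.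
Proof.
move=> m_gt0.
rewrite monicE /shifted_split_poly lead_coefDl ?size_prod ?size_poly1 // -monicE.
exact: monic_prod_XsubC.
Qed.

(** The factor of index 0 is [x] itself, so a root satisfies [x * y = -1], where [y] is the product
    of the other factors. *)
Lemma root_shifted_split_unit (x : algC) :
  (0 < m)%N -> root (p algC) x -> [/\ x != 0, x \in Aint & x^-1 \in Aint].
Proof.
move=> m_gt0 rx.
have xA : x \in Aint.
  apply: (root_monic_Aint rx); first exact: shifted_split_poly_monic.
  apply/polyOverP=> i; rewrite -(map_shifted_split_poly (intr : int -> algC)).
  by rewrite coef_map; apply: intr_int.
move: rx; rewrite root_shifted_split_poly; case: (m) m_gt0 => // k _.
rewrite big_ord_recl muln0 subr0 => /eqP; set y := \prod_(i < k) _ => xy.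
have yA : y \in Aint.
  by apply: rpred_prod => i _; rewrite rpredB // rpred_nat.
have x0 : x != 0.
  by apply/eqP=> x0; move/eqP: xy; rewrite x0 mul0r eq_sym oppr_eq0 oner_eq0.
split=> //; suff -> : x^-1 = - y by rewrite rpredN.
by apply: (mulfI x0); rewrite mulfV // mulrN xy opprK.
Qed.

(* On the unit circle, |x - 4 i| >= 3 for i > 0, so the product of the x - 4 i
   cannot be -1. *)
Lemma root_shifted_split_norm (x : algC) :
  (1 < m)%N -> root (p algC) x -> `|x| != 1.
Proof.
move=> m_gt1; rewrite root_shifted_split_poly => /eqP xm.
apply/eqP=> x1; move/(congr1 Num.norm): xm.
rewrite normrN1 normr_prod => /eqP; apply/negP; rewrite gt_eqF //.
case: (m) m_gt1 => [//|[//|k]] _.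
rewrite !big_ord_recl /= muln0 subr0 x1 mul1r.
have far i : (3 : algC) <= `|x - (4 * i.+1)%:R|.
  rewrite distrC; apply: le_trans (lerB_dist _ _); rewrite x1 normr_nat.
  by rewrite lerBrDr natr1 ler_nat; lia.
apply: (@lt_le_trans _ _ (3 * 1)); first by rewrite mulr1 ltr1n.
apply: ler_pM; rewrite ?ler01 ?ler0n ?far //.
apply: (big_ind (fun y => 1 <= y)) => [//|y z|i _]; first exact: mulr_ege1.
rewrite /= /bump /= add1n.
by apply: le_trans (far _); rewrite ler1n.
Qed.

Lemma root_shifted_split_real (R : rcfType) :
  exists2 xi : 'I_m -> R, injective xi & forall i, root (p R) (xi i).
Proof.
have ex (i : 'I_m) : exists x : R,
    root (p R) x && ((4 * i)%:R - 1 <= x <= (4 * i)%:R + 1).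
  pose q (e : R) := \prod_(j < m) ((4 * i)%:R + e - (4 * j)%:R).
  have pq e : (p R).[(4 * i)%:R + e] = q e + 1.
    rewrite /shifted_split_poly hornerD horner_prod hornerC; congr (_ + 1).
    by apply: eq_bigr => j _; rewrite !hornerE.
  have fac (e : int) (j : 'I_m) : (4 * i)%:R + e%:~R - (4 * j)%:R
      = ((4 * i)%:Z + e - (4 * j)%:Z)%:~R :> R.
    by rewrite intrB intrD !pmulrn.
  (* For [e = 1] or [-1] every factor is an odd integer, hence nonzero. *)
  have q1 (e : int) : `|e| = 1 -> 1 <= `|q e%:~R|.
    move=> e1; rewrite normr_prod.
    apply: (big_ind (fun y => 1 <= y)) => [//|y z|j _]; first exact: mulr_ege1.
    rewrite fac -intr_norm (ler_int _ 1) /=; lia.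
  (* The factors of index [i] contribute [-1]; those of index [j] contribute
     [(4 (i - j))^2 - 1 > 0]. *)
  have qN : q (-1)%:~R * q 1%:~R <= 0.
    rewrite -big_split (bigD1 i) //= mulr_le0_ge0 //.
      by rewrite !fac -intrM (ler_int _ _ 0); lia.
    apply: prodr_ge0 => j ji; rewrite !fac -intrM (ler_int _ 0).
    have: (j : nat) != i by apply: contraNneq ji => /val_inj ->.
    by move=> ?; nia.
  have lei : (4 * i)%:R - 1 <= (4 * i)%:R + 1 :> R by lra.
  have := q1 (-1) erefl; have := q1 1 erefl; move: qN.
  (* Equal signs contradict [qN]. Otherwise [p] is at most 0 at one end of the interval and at least
     2 at the other. *)
  rewrite mulrN1z mulr1z !ler_normr => qN /orP[qp|qn] /orP[qp'|qn']; [nra| | |nra].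
    have [|x xi rx] := @poly_ivt R (p R) _ _ lei.
      by rewrite !pq; apply/andP; split; lra.
    by exists x; rewrite rx xi.
  have [|x xi rx] := @poly_ivt R (- p R) _ _ lei.
    by rewrite !hornerN !pq; apply/andP; split; lra.
  by exists x; rewrite -rootN rx xi.
have [xi xiP] := fin_all_exists ex.
exists xi => [i j ij|i]; last by case/andP: (xiP i).
(* A common root would lie within 1 of two distinct multiples of 4. *)
apply/val_inj/eqP => /=.
case/and3P: (xiP i) => _; case/and3P: (xiP j) => _; rewrite -ij => a b c d.
rewrite eqn_leq; apply/andP; split; rewrite leqNgt; apply/negP=> lt.
  have : (4 * j + 4)%:R <= (4 * i)%:R :> R by rewrite ler_nat; lia.
  by rewrite natrD; lra.
have : (4 * i + 4)%:R <= (4 * j)%:R :> R by rewrite ler_nat; lia.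
by rewrite natrD; lra.
Qed.

End ShiftedSplitPoly.

(** The transpose of [companionmx p] is taken so that the powers of a root form a row eigenvector.
    The morphism [f] allows roots in an extension, such as real roots of a rational polynomial. *)
Lemma companion_matrix (m : nat) (K : comNzRingType) (p : {poly K}) :
  p \is monic -> size p = m.+1 ->
  exists2 C : 'M[K]_m, char_poly C = p
  & forall (L : comNzRingType) (f : {rmorphism K -> L}) (x : L), root (map_poly f p) x ->
    (\row_(j < m) x ^+ j) *m map_mx f C = x *: \row_j x ^+ j.
Proof.
move=> p_mon sp; have := companionmxK p_mon; set M := companionmx p.
have ME : forall i j, M i j = if i == (size p).-2 :> nat then - p`_j else (i.+1 == j :> nat)%:R.
  by move=> i j; rewrite mxE.
move: M ME; rewrite sp /= => M ME charM.
exists M^T; first by rewrite -charM /char_poly -[RHS]det_tr /char_poly_mx linearB /= tr_scalar_mx map_trmx.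
move=> L f x; rewrite rootE => /eqP px; apply/rowP=> j; rewrite !mxE.
under eq_bigr do rewrite !mxE ME.
(* In the last column [p(x) = 0] rewrites [x ^+ m] by lower powers; the other columns are shifts. *)
case: eqP => [jm|/eqP jm].
  have szp : size (map_poly f p) = m.+1.
    rewrite size_map_poly_id0 ?sp // (monicP p_mon) rmorph1; exact: oner_neq0.
  have pm : f p`_m = 1.
    by move/monicP: p_mon; rewrite lead_coefE sp /= => ->; apply: rmorph1.
  move: px; rewrite horner_coef szp big_ord_recr /= coef_map /= pm mul1r.
  move/eqP; rewrite addrC addr_eq0 => /eqP xm.
  rewrite -exprS jm (ltn_predK (ltn_ord j)) xm -sumrN.
  by apply: eq_bigr => i _; rewrite coef_map /= rmorphN mulrN mulrC.
have jm1 : (j.+1 < m)%N by move: (ltn_ord j) jm; lia.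
rewrite (bigD1 (Ordinal jm1)) //= eqxx (rmorph_nat f) mulr1 big1 ?addr0 ?exprS // => i ij.
by rewrite [_ == _](introF eqP) ?(rmorph_nat f) ?mulr0 // => E; case/eqP: ij; apply: val_inj.
Qed.

(** Stated for a bare [linear] hypothesis, so that it applies to a bracket with either argument
    fixed. *)
Lemma linear_sumZ (K : fieldType) (m n p : nat) (f : 'M[K]_(1, m) -> 'M[K]_(n, p))
    (k : nat) (a : 'I_k -> K) (x : 'I_k -> 'M[K]_(1, m)) :
  linear f -> f (\sum_i a i *: x i) = \sum_i a i *: f (x i).
Proof.
move=> lin_f; have f0 : f 0 = 0.
  by have := lin_f (-1) 0 0; rewrite scaler0 addr0 scaleN1r addNr.
by elim/big_rec2: _ => [|i y1 y2 _ <-] //; rewrite lin_f.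
Qed.

(** * Brackets given by structure constants, and gradings *)

Section LieBracket.

Variables (K : fieldType) (n : nat).
Implicit Types (c : 'I_n -> 'I_n -> 'rV[K]_n) (u v : 'rV[K]_n) (M : 'M[K]_n).

(** The matrix of [ad u], acting on row vectors from the right. *)
Definition lie_ad c u : 'M[K]_n := \sum_i u 0 i *: \matrix_j c i j.

Lemma lie_ad_linear c : linear (lie_ad c).
Proof.
move=> a u v; rewrite /lie_ad scaler_sumr -big_split; apply: eq_bigr => i _.
by rewrite !mxE scalerDl scalerA.
Qed.

Lemma lie_bracketE c u v : lie_bracket c u v = v *m lie_ad c u.
Proof.
rewrite /lie_ad mulmx_sumr; apply: eq_bigr => i _.
rewrite -scalemxAr mulmx_sum_row scaler_sumr; apply: eq_bigr => j _.
by rewrite rowK scalerA.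
Qed.

Lemma lie_bracket_linearr c u : linear (lie_bracket c u).
Proof. by move=> a v w; rewrite !lie_bracketE mulmxDl -scalemxAl. Qed.

Lemma lie_bracket_linearl c v : linear (lie_bracket c ^~ v).
Proof.
by move=> a u w; rewrite !lie_bracketE lie_ad_linear mulmxDr -scalemxAr.
Qed.

Lemma lie_bracket0l c v : lie_bracket c 0 v = 0.
Proof.
have := lie_bracket_linearl c v (-1) 0 0.
by rewrite scaler0 addr0 scaleN1r addNr.
Qed.

Lemma lie_bracket_bilinear (g : 'rV[K]_n -> 'rV[K]_n -> 'rV[K]_n) u v :
  (forall y, linear (g ^~ y)) -> (forall x, linear (g x)) ->
  lie_bracket (fun i j => g (delta_mx 0 i) (delta_mx 0 j)) u v = g u v.
Proof.
move=> gl gr; rewrite {2}(row_sum_delta u) (@linear_sumZ _ _ _ _ (g^~ v)) //.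
apply: eq_bigr => i _; rewrite {2}(row_sum_delta v) linear_sumZ // scaler_sumr.
by apply: eq_bigr => j _; rewrite scalerA.
Qed.

(** Reduces brackets of projected vectors to brackets of rows of the projections, for which the
    grading condition is stated. *)
Lemma lie_bracket_mul c u v M M' :
  lie_bracket c (u *m M) (v *m M') =
  lie_bracket (fun a b => lie_bracket c (row a M) (row b M')) u v.
Proof.
pose g x y := lie_bracket c (x *m M) (y *m M').
rewrite -[LHS]/(g u v) -(@lie_bracket_bilinear g).
- by apply: eq_bigr => i _; apply: eq_bigr => j _; rewrite /g -!rowE.
- by move=> y a x z; rewrite /g mulmxDl -scalemxAl lie_bracket_linearl.
- by move=> y a x z; rewrite /g mulmxDl -scalemxAl lie_bracket_linearr.
Qed.

Lemma lie_bracket_mulr c u v M :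
  lie_bracket c u v *m M = lie_bracket (fun a b => c a b *m M) u v.
Proof.
rewrite /lie_bracket mulmx_suml; apply: eq_bigr => i _.
by rewrite mulmx_suml; apply: eq_bigr => j _; rewrite scalemxAl.
Qed.

(* [P i] is the projection onto the degree [i] component along the other
   components; it vanishes for [i = 0] and for [i > k]. *)
Definition grading_projections c (k : nat) (P : nat -> 'M[K]_n) :=
  [/\ P 0 = 0, \sum_(i < k.+1) P i = 1%:M,
      forall i j, P i *m P j = (i == j)%:R *: P i
    & forall i j a b,
        let x := lie_bracket c (row a (P i)) (row b (P j)) in x *m P (i + j)%N = x].

Definition grading_dilation (k : nat) (P : nat -> 'M[K]_n) (t : K) : 'M[K]_n :=
  \sum_(i < k.+1) t ^+ i *: P i.

(** The bracket of the components of degrees [i] and [j] is scaled by [t ^+ i * t ^+ j], and lies in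
    degree [i + j], where the dilation is multiplication by [t ^+ (i + j)]. *)
Lemma grading_dilation_morph c k P t u v : grading_projections c k P ->
  lie_bracket c (u *m grading_dilation k P t) (v *m grading_dilation k P t) =
  lie_bracket c u v *m grading_dilation k P t.
Proof.
case=> _ sumP PP brP; pose b i j := lie_bracket c (u *m P i) (v *m P j).
have bP i j : b i j *m P (i + j)%N = b i j.
  rewrite /b lie_bracket_mul lie_bracket_mulr.
  by apply: eq_bigr => x _; apply: eq_bigr => y _; rewrite brP.
have PF i : P i *m grading_dilation k P t = t ^+ i *: P i.
  rewrite mulmx_sumr; have [ik|ki] := ltnP i k.+1.
    rewrite (bigD1 (Ordinal ik)) //= -scalemxAr PP eqxx scale1r big1 ?addr0 //.
    move=> j ji; rewrite -scalemxAr PP (_ : _ == _ = false) ?scale0r ?scaler0 //.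
    by apply: contraNF ji => /eqP ij; apply/eqP/val_inj.
  (* Degrees above [k] occur as sums [i + j]; there [P i] is killed by every term of [sumP]. *)
  have Pi0 : P i = 0.
    rewrite -[P i]mulmx1 -sumP mulmx_sumr big1 // => j _.
    by rewrite PP gtn_eqF ?scale0r // (leq_trans (ltn_ord j)).
  by rewrite Pi0 scaler0 big1 // => j _; rewrite mul0mx.
have brF r : lie_bracket c (u *m grading_dilation k P r) (v *m grading_dilation k P r)
    = \sum_(i < k.+1) \sum_(j < k.+1) r ^+ (i + j) *: b i j.
  have mulF w : w *m grading_dilation k P r = \sum_(i < k.+1) r ^+ i *: (w *m P i).
    by rewrite mulmx_sumr; apply: eq_bigr => i _; rewrite -scalemxAr.
  rewrite !mulF (@linear_sumZ _ _ _ _ (lie_bracket c ^~ _)); last first.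
    exact: lie_bracket_linearl.
  apply: eq_bigr => i _; rewrite linear_sumZ; last exact: lie_bracket_linearr.
  by rewrite scaler_sumr; apply: eq_bigr => j _; rewrite scalerA exprD.
(* The dilation by 1 is the identity, so [brF] at 1 expands the undilated bracket. *)
have F1 : grading_dilation k P 1 = 1%:M.
  by rewrite -sumP; apply: eq_bigr => i _; rewrite expr1n scale1r.
have := brF 1; rewrite F1 !mulmx1 brF => ->.
rewrite mulmx_suml; apply: eq_bigr => i _; rewrite mulmx_suml; apply: eq_bigr => j _.
by rewrite expr1n scale1r -{2}bP -mulmxA PF -scalemxAr bP.
Qed.

Lemma graded_projections c : graded (lie_bracket c) ->
  exists k, exists P, grading_projections c k P.
Proof.
case=> k [V [sumV [dirV brV]]]; exists k.
have {}dirV : mxdirect (\sum_(i < k) V i.+1)%MS.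
  move/mxdirectP: dirV => /= dirV; apply/mxdirectP => /=.
  by rewrite !big_add1 /= !big_mkord in dirV.
have {}sumV : (1%:M <= \sum_(i < k) V i.+1)%MS.
  by case/andP: sumV => _; rewrite big_add1 /= big_mkord.
pose Q (i : 'I_k) := proj_mx (V i.+1) (\sum_(j < k | j != i) V j.+1)%MS.
have dirVi (i : 'I_k) : (V i.+1 :&: \sum_(j < k | j != i) V j.+1)%MS = 0.
  exact: (mxdirect_sumsP dirV).
have QV q (i : 'I_k) (x : 'M_(q, n)) : (x *m Q i <= V i.+1)%MS by apply: proj_mx_sub.
have Qid q (i : 'I_k) (x : 'M_(q, n)) : (x <= V i.+1)%MS -> x *m Q i = x.
  exact: proj_mx_id.
have Q0 q (i j : 'I_k) (x : 'M_(q, n)) : (x <= V j.+1)%MS -> j != i -> x *m Q i = 0.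
  move=> xV ji; apply: proj_mx_0 => //; apply: submx_trans xV _.
  exact: (sumsmx_sup j).
have sumQ : \sum_i Q i = 1%:M.
  have [X X1] := sub_sumsmxP sumV; rewrite X1; apply: eq_bigr => i _.
  rewrite -[LHS]mul1mx {1}X1 mulmx_suml (bigD1 i) //= Qid ?submxMl // big1 ?addr0 //.
  by move=> j ji; rewrite (Q0 _ _ j) ?submxMl.
(* This sum has at most one term; it extends the projections to all natural indices, with value 0 at
   0 and above [k]. *)
pose P d := \sum_(i < k | i.+1 == d) Q i.
have PS (i : 'I_k) : P i.+1 = Q i by apply: big_pred1 => j; rewrite /= eqSS.
have P0 : P 0 = 0 by rewrite /P big_pred0.
have Pcase d : P d = 0 \/ exists i : 'I_k, d = i.+1.
  case: d => [|d]; first by left.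
  have [dk|kd] := ltnP d k; first by right; exists (Ordinal dk).
  left; rewrite /P big_pred0 // => i; apply/eqP=> -[id].
  by rewrite leqNgt -id ltn_ord in kd.
exists P; split=> //.
- by rewrite big_ord_recl P0 add0r -sumQ; apply: eq_bigr => i _; rewrite PS.
- move=> d e; case: (Pcase d) => [-> | [i ->]]; first by rewrite mul0mx scaler0.
  case: (Pcase e) => [Pe | [j ->]].
    by rewrite Pe mulmx0; case: eqP => [->|_]; rewrite ?Pe ?scaler0 ?scale0r.
  rewrite !PS eqSS; have [<-|ji] := eqVneq i j.
    by rewrite eqxx scale1r Qid // -[Q i]mul1mx.
  rewrite (_ : _ == _ = false) ?scale0r; last exact/negbTE.
  by rewrite (Q0 _ _ i) // -[Q i]mul1mx.
move=> d e a b /=; set x := lie_bracket _ _ _.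
case: (Pcase d) => [Pd | [i Ed]].
  by rewrite /x Pd row0 lie_bracket0l mul0mx.
case: (Pcase e) => [Pe | [j Ee]].
  by rewrite /x Pe row0 lie_bracketE !mul0mx.
have rowV (l : 'I_k) (r : 'I_n) : (row r (P l.+1) <= V l.+1)%MS.
  by rewrite PS rowE.
have := brV d e (row a (P d)) (row b (P e)); rewrite -/x Ed Ee !rowV.
rewrite !ltn_ord /= => /(_ isT isT isT isT).
(* Either the bracket lies in [V (i + j)], which the projection fixes, or the degree exceeds [k] and
   the bracket is 0. *)
case: ifP => [ijk xV | _ /eqP ->]; last by rewrite mul0mx.
have lk : (i + j.+1 < k)%N by [].
by rewrite addSn (PS (Ordinal lk)) Qid.
Qed.

End LieBracket.

(** * Change of the base field *)

Section MapLie.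

Variables (K L : fieldType) (f : {rmorphism K -> L}) (n : nat).
Variable c : 'I_n -> 'I_n -> 'rV[K]_n.

Lemma map_lie_ad u :
  map_mx f (lie_ad c u) = lie_ad (fun i j => map_mx f (c i j)) (map_mx f u).
Proof.
rewrite /lie_ad raddf_sum; apply: eq_bigr => i _.
rewrite /= map_mxZ mxE; congr (_ *: _); apply/row_matrixP=> j.
by rewrite -map_row !rowK.
Qed.

Lemma map_lie_bracket u v :
  map_mx f (lie_bracket c u v) =
  lie_bracket (fun i j => map_mx f (c i j)) (map_mx f u) (map_mx f v).
Proof. by rewrite !lie_bracketE map_mxM map_lie_ad. Qed.

Lemma map_grading_projections k P : grading_projections c k P ->
  grading_projections (fun i j => map_mx f (c i j)) k (fun i => map_mx f (P i)).
Proof.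
case=> P0 sumP PP brP; split.
- by rewrite P0 map_mx0.
- by rewrite -(map_mx1 f) -sumP raddf_sum.
- by move=> i j; rewrite -map_mxM PP map_mxZ rmorph_nat.
- by move=> i j a b /=; rewrite -!map_row -map_lie_bracket -map_mxM brP.
Qed.

Lemma map_mx_exp m (C : 'M[K]_m) i : map_mx f (C ^+ i) = map_mx f C ^+ i.
Proof.
elim: i => [|i IHi]; first by rewrite !expr0 map_mx1.
by rewrite !exprS -IHi; apply: map_mxM.
Qed.

End MapLie.

(* With [C] the matrix of multiplication by [x] on [E = K[x] / (p)] in the basis
   of powers of [x], an [m x n] matrix [U] stands for the element
   [\sum_a x ^ a (x) row a U] of the Lie algebra [E (x) K^n]. *)
Section ExtensionOfScalars.

Variables (K : fieldType) (m n : nat).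
Variables (C : 'M[K]_m) (c : 'I_n -> 'I_n -> 'rV[K]_n).
Variables (k : nat) (P : nat -> 'M[K]_n).
Implicit Types U V : 'M[K]_(m, n).

(** Expands [U] in powers of [x]: the bracket of [x ^ a (x) u] with [V] is [x ^ a] times [ad u]
    applied to each row of [V]. *)
Definition ext_bracket U V : 'M[K]_(m, n) :=
  \sum_(a < m) C ^+ a *m V *m lie_ad c (row a U).

Definition ext_structure (i j : 'I_(m * n)) : 'rV[K]_(m * n) :=
  mxvec (ext_bracket (vec_mx (delta_mx 0 i)) (vec_mx (delta_mx 0 j))).

Lemma ext_structureE u v :
  lie_bracket ext_structure u v = mxvec (ext_bracket (vec_mx u) (vec_mx v)).
Proof.
pose g u v := mxvec (ext_bracket (vec_mx u) (vec_mx v)).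
rewrite -[RHS]/(g u v) -(@lie_bracket_bilinear _ _ g) // => w t x y; rewrite /g.
  rewrite -linearP; congr mxvec; rewrite /ext_bracket scaler_sumr -big_split /=.
  apply: eq_bigr => a _.
  by rewrite !linearP /= lie_ad_linear mulmxDr -scalemxAr.
rewrite -linearP; congr mxvec; rewrite /ext_bracket scaler_sumr -big_split /=.
by apply: eq_bigr => a _; rewrite !linearP /= mulmxDl -scalemxAl.
Qed.

Definition ext_dilation U : 'M[K]_(m, n) := \sum_(i < k.+1) C ^+ i *m U *m P i.

Definition ext_dilation_mx : 'M[K]_(m * n) :=
  \sum_(i < k.+1) lin_mx (mulmx (C ^+ i)) *m lin_mx (mulmxr (P i)).

Lemma mul_ext_dilation_mx u :
  u *m ext_dilation_mx = mxvec (ext_dilation (vec_mx u)).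
Proof.
rewrite mulmx_sumr linear_sum; apply: eq_bigr => i _.
by rewrite mulmxA !mul_rV_lin /= mxvecK.
Qed.

(** Some component [U *m P j] of an eigenvector [U] is nonzero, and [C ^+ j] multiplies it by [z];
    [j] is positive because [P 0 = 0]. *)
Lemma ext_dilation_eigenvalue z : grading_projections c k P ->
  eigenvalue ext_dilation_mx z -> exists2 j, (0 < j)%N & eigenvalue (C ^+ j) z.
Proof.
case=> P0 sumP PP _ /eigenvalueP[u]; rewrite mul_ext_dilation_mx => Au u0.
set U := vec_mx u in Au.
have {}Au : ext_dilation U = z *: U by rewrite -(mxvecK (ext_dilation U)) Au linearZ.
have [j UPj] : exists j : 'I_k.+1, U *m P j != 0.
  apply/existsP; apply: contraNT u0; rewrite negb_exists => /forallP UP0.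
  rewrite -(vec_mxK u) -/U -[U]mulmx1 -sumP mulmx_sumr big1 ?linear0 // => i _.
  by apply/eqP/negPn/UP0.
exists j; first by rewrite lt0n; apply: contraNneq UPj => ->; rewrite P0 mulmx0.
apply: eigenvalue_col UPj; rewrite scalemxAl -Au /ext_dilation mulmx_suml.
rewrite (bigD1 j) //= big1 ?addr0 => [|i ij].
  by rewrite -!mulmxA PP eqxx scale1r.
rewrite -mulmxA PP (_ : _ == _ = false) ?scale0r ?mulmx0 //.
by apply: contraNF ij => /eqP E; apply/eqP/val_inj.
Qed.

End ExtensionOfScalars.

Lemma map_ext_dilation_mx (K L : fieldType) (f : {rmorphism K -> L}) m n
    (C : 'M[K]_m) k (P : nat -> 'M[K]_n) :
  map_mx f (ext_dilation_mx C k P) =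
  ext_dilation_mx (map_mx f C) k (fun i => map_mx f (P i)).
Proof.
rewrite /ext_dilation_mx raddf_sum; apply: eq_bigr => i _.
rewrite /= map_mxM; congr (_ *m _); apply: map_lin_mx => M /=.
  by rewrite map_mxM map_mx_exp.
by rewrite map_mxM.
Qed.

(* The rows of [W] are the [L]-points of the algebra of [C]: left multiplication
   by [W] is the map [E (x) K^n -> (L^n)^m] evaluating at the [xi s]. *)
Section Splitting.

Variables (K L : fieldType) (f : {rmorphism K -> L}) (m n : nat).
Variables (C : 'M[K]_m) (c : 'I_n -> 'I_n -> 'rV[K]_n).
Variables (k : nat) (P : nat -> 'M[K]_n).
Variables (xi : 'I_m -> L).
Hypothesis xi_inj : injective xi.

Let W : 'M[L]_m := \matrix_(s, a) xi s ^+ a.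
Let cL i j := map_mx f (c i j).

Hypothesis rowC : forall s, row s W *m map_mx f C = xi s *: row s W.

Let rowCX s i : row s W *m map_mx f (C ^+ i) = xi s ^+ i *: row s W.
Proof.
elim: i => [|i IHi]; first by rewrite !expr0 map_mx1 mulmx1 scale1r.
rewrite exprSr (map_mxM f (C ^+ i)) mulmxA IHi -scalemxAl rowC scalerA.
by rewrite -exprSr.
Qed.

Lemma split_mx_unit : W \in unitmx.
Proof.
rewrite -unitmx_tr (_ : W^T = Vandermonde m (\row_s xi s)); last first.
  by apply/matrixP=> i j; rewrite !mxE.
rewrite unitmxE unitfE det_Vandermonde.
apply/prodf_neq0 => i _; apply/prodf_neq0 => j ij.
by rewrite !mxE subr_eq0 (inj_eq xi_inj) neq_ltn ij orbT.
Qed.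

Lemma split_inj (U V : 'M[K]_(m, n)) :
  W *m map_mx f U = W *m map_mx f V -> U = V.
Proof. by move/(can_inj (mulKmx split_mx_unit))/map_mx_inj. Qed.

(** Evaluation at [xi s] is a Lie homomorphism, since it turns multiplication by [x] into
    multiplication by [xi s]. *)
Lemma row_split_bracket s (U V : 'M[K]_(m, n)) :
  row s (W *m map_mx f (ext_bracket C c U V)) =
  lie_bracket cL (row s (W *m map_mx f U)) (row s (W *m map_mx f V)).
Proof.
rewrite lie_bracketE !row_mul raddf_sum mulmx_sumr.
rewrite [X in lie_ad _ X]mulmx_sum_row linear_sumZ; last exact: lie_ad_linear.
rewrite mulmx_sumr; apply: eq_bigr => a _.
rewrite /= !map_mxM !mulmxA rowCX -!scalemxAl -scalemxAr map_lie_ad.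
by rewrite map_row !mxE.
Qed.

Lemma row_split_dilation s (U : 'M[K]_(m, n)) :
  row s (W *m map_mx f (ext_dilation C k P U)) =
  row s (W *m map_mx f U) *m grading_dilation k (fun i => map_mx f (P i)) (xi s).
Proof.
rewrite !row_mul raddf_sum !mulmx_sumr; apply: eq_bigr => i _.
by rewrite /= !map_mxM !mulmxA rowCX -!scalemxAl -scalemxAr.
Qed.

(** After evaluation at each [xi s] the map becomes the grading dilation by [xi s], a morphism;
    evaluation at all the [xi s] together is injective. *)
Lemma ext_dilation_morph (U V : 'M[K]_(m, n)) : grading_projections c k P ->
  ext_bracket C c (ext_dilation C k P U) (ext_dilation C k P V) =
  ext_dilation C k P (ext_bracket C c U V).
Proof.
move=> gP; apply: split_inj; apply/row_matrixP=> s.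
rewrite row_split_bracket !row_split_dilation row_split_bracket.
exact/grading_dilation_morph/map_grading_projections.
Qed.

Lemma split_basis_unit : lin_mx (mulmx W) \in @unitmx L (m * n).
Proof.
suff /mulmx1_unit[] : lin_mx (mulmx W) *m lin_mx (mulmx (invmx W)) = 1%:M :> 'M_(m * n) by [].
apply/row_matrixP=> i; rewrite !rowE mulmxA !mul_rV_lin /= mxvecK.
by rewrite mulKmx ?split_mx_unit // vec_mxK mulmx1.
Qed.

(** The rows of [lin_mx (mulmx W)] are the evaluations of the basis elements [x ^ a (x) e_b]. *)
Lemma split_basis_bracket (i j : 'I_(m * n)) :
  dsum_bracket (lie_bracket cL) (row i (lin_mx (mulmx W))) (row j (lin_mx (mulmx W))) =
  map_mx f (ext_structure C c i j) *m lin_mx (mulmx W).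
Proof.
rewrite mul_rV_lin /= -map_vec_mx mxvecK /dsum_bracket; congr mxvec.
apply/row_matrixP=> s; rewrite rowK row_split_bracket.
by rewrite !rowE !mul_rV_lin /= !mxvecK !map_vec_mx !map_delta_mx -!rowE.
Qed.

End Splitting.

Unset Implicit Arguments.
Set Strict Implicit.

Theorem theorem3p1 (n : nat) (c : 'I_n -> 'I_n -> 'rV[rat]_n)
  (hlie : is_lie (lie_bracket c)) (hgr : graded (lie_bracket c))
  (m : nat) (hm : (2 <= m)%N) (R : rcfType) :
  exists (B : 'M[R]_(m * n)) (d : 'I_(m * n) -> 'I_(m * n) -> 'rV[rat]_(m * n)),
    rational_form (@dsum_bracket R n m (lie_bracket (fun i j => map_mx (@ratr R) (c i j)))) B d
    /\ anosov (lie_bracket d).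
Proof.
have m_gt0 : (0 < m)%N by apply: ltnW.
have [k [P gP]] := graded_projections hgr.
have [C charC rowC] := companion_matrix
  (shifted_split_poly_monic rat m_gt0) (size_shifted_split_poly rat m_gt0).
have [xi xi_inj xi_root] := root_shifted_split_real m R.
have rowWC s : row s (\matrix_(s, a < m) xi s ^+ a) *m map_mx (@ratr R) C
    = xi s *: row s (\matrix_(s, a) xi s ^+ a).
  have -> : row s (\matrix_(s, a < m) xi s ^+ a) = \row_a xi s ^+ a.
    by apply/rowP=> a; rewrite !mxE.
  by apply: (rowC R (@ratr R)); rewrite map_shifted_split_poly.
(* The real basis is the image of the basis of [E (x) n] under evaluation at the real roots. *)
exists (lin_mx (mulmx (\matrix_(s, a) xi s ^+ a))), (ext_structure C c).
split; first split.
- exact: split_basis_unit.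
- by move=> i j; apply: split_basis_bracket.
set A := ext_dilation_mx C k P.
have eigA (z : algC) : eigenvalue (map_mx ratr A) z ->
    exists2 w, root (shifted_split_poly algC m) w & exists2 j, (0 < j)%N & z = w ^+ j.
  rewrite map_ext_dilation_mx.
  case/(ext_dilation_eigenvalue (map_grading_projections _ gP)).
  move=> j j_gt0 /(eigenvalue_exp j_gt0)[w wC ->]; exists w; last by exists j.
  by rewrite eigenvalue_root_char -map_char_poly charC map_shifted_split_poly in wC.
have [|uA intA detA] := @unit_eigenvalues_int _ A.
  move=> z /eigA[w /root_shifted_split_unit[]// w0 wA wVA [j _ ->]].
  by rewrite expf_neq0 // -exprVn !rpredX.
exists A; split=> //; split; last split; last by split.
  (* This identity over [rat] is tested after evaluation at the roots [xi] in [R]. *)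
  move=> u v; rewrite !ext_structureE !mul_ext_dilation_mx !mxvecK.
  by rewrite (ext_dilation_morph xi_inj rowWC).
move=> z /eigA[w /(root_shifted_split_norm hm) w1 [j j_gt0 ->]].
by rewrite normrX pexpr_eq1 ?normr_ge0 // w1.
Qed.
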